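(* Let $D,E$ be operators, $\langle W|$ a row vector and $|V\rangle$ a column vector satisfying $$DE-qED=D+E,\qquad \langle W|E=\langle W|,\qquad D|V\rangle=|V\rangle,\qquad \langle W|V\rangle=1 .$$ Then for every integer $n\ge 1$, $y\langle W|(yD+E)^{n-1}|V\rangle$ is the generating polynomial (sum of the weights) of weighted bi-coloured Motzkin paths of length $n$, where the weight of a path is the product of the weights of its steps and the weight of a step starting at height $i$ is \begin{itemize} \item $y+yq+\cdots+yq^i=y\frac{1-q^{i+1}}{1-q}$ if it is a north-east step or an east step of type 1, and \item $1+q+\cdots+q^{i-1}=\frac{1-q^i}{1-q}$ if it is a south-east step or an east step of type 2. \end{itemize}
   Context: $q$ and $y$ are commuting indeterminates (scalars). $D,E$ are linear operators on a vector space over a field containing $\mathbb{Q}(q,y)$ (for instance, suitable infinite matrices), $|V\rangle$ is a vector of that space, and $\langle W|$ is a linear functional on it; $\langle W|X|V\rangle$ denotes the resulting scalar. A bi-coloured Motzkin path of length $n$ is a lattice path with $n$ steps, starting at height $0$, ending at height $0$, never going below height $0$, whose steps are north-east steps $(1,1)$, south-east steps $(1,-1)$, and two types (type 1 and type 2) of east steps $(1,0)$. (An east step of type 2 starting at height $0$ has weight $0$.) *)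

(* Defs.v *)
From HB Require Import structures.
From mathcomp Require Import all_boot all_order all_algebra.

Set Implicit Arguments.
Unset Strict Implicit.
Unset Printing Implicit Defensive.

Import Order.TTheory GRing.Theory Num.Theory.
Local Open Scope ring_scope.

(* Q[q, y] as (Q[q])[y]: q is the inner variable, y the outer one. *)
Notation polyQqy := {poly {poly rat}}.
Notation ratQqy := {fraction {poly {poly rat}}}.
Notation "p %:F" := (@FracField.tofrac polyQqy p) : ring_scope.

Definition q_ : polyQqy := 'X%:P.
Definition y_ : polyQqy := 'X.

Inductive step := NorthEast | SouthEast | East1 | East2.

Definition step_code (s : step) : bool * bool :=
  match s with
  | NorthEast => (true, true)
  | SouthEast => (true, false)
  | East1 => (false, true)
  | East2 => (false, false)
  end.

Definition step_decode (c : bool * bool) : step :=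
  match c with
  | (true, true) => NorthEast
  | (true, false) => SouthEast
  | (false, true) => East1
  | (false, false) => East2
  end.

Lemma step_codeK : cancel step_code step_decode.
Proof. by case. Qed.

HB.instance Definition _ := Finite.copy step (can_type step_codeK).

Definition rise (s : step) : int :=
  match s with
  | NorthEast => 1
  | SouthEast => -1
  | East1 | East2 => 0
  end.

(* Ordinate after the first k steps, i.e. the height at which step number k
   (counted from 0) starts. *)
Definition height (p : seq step) (k : nat) : int :=
  \sum_(s <- take k p) rise s.

Definition motzkin (n : nat) (p : n.-tuple step) : bool :=
  [forall k : 'I_n.+1, 0 <= height p k] && (height p n == 0).

(* East2 at height 0 has weight 0, the sum being empty. *)
Definition step_weight (i : nat) (s : step) : polyQqy :=
  match s with
  | NorthEast | East1 => \sum_(k < i.+1) y_ * q_ ^+ k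
  | SouthEast | East2 => \sum_(k < i) q_ ^+ k
  end.

(* The absolute value only converts a height to nat: heights are nonnegative
   along the paths that are summed over in motzkin_gf. *)
Definition path_weight (n : nat) (p : n.-tuple step) : polyQqy :=
  \prod_(k < n) step_weight `|height p k|%N (tnth p k).

Definition motzkin_gf (n : nat) : polyQqy :=
  \sum_(p : n.-tuple step | motzkin p) path_weight p.

Lemma one_sub_q_neq0 : 1 - q_%:F != 0 :> ratQqy.
Proof.
rewrite -tofrac1 -tofracB tofrac_eq0 /q_ -polyC1 -polyCB polyC_eq0.
by rewrite -opprB oppr_eq0 polyXsubC_eq0.
Qed.

Lemma geometric_frac (i : nat) :
  (\sum_(k < i) q_ ^+ k)%:F = (1 - q_%:F ^+ i) / (1 - q_%:F) :> ratQqy.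
Proof.
apply: (canRL (mulfK one_sub_q_neq0)).
rewrite mulrC -[1 - q_%:F ^+ i]opprB subrX1 -mulNr opprB rmorph_sum.
by congr (_ * _); apply: eq_bigr => k _; exact: rmorphXn.
Qed.

Lemma step_weight_up (i : nat) (s : step) :
  s = NorthEast \/ s = East1 ->
  (step_weight i s)%:F = y_%:F * ((1 - q_%:F ^+ i.+1) / (1 - q_%:F)) :> ratQqy.
Proof. by case=> ->; rewrite /= -mulr_sumr tofracM geometric_frac. Qed.

Lemma step_weight_down (i : nat) (s : step) :
  s = SouthEast \/ s = East2 ->
  (step_weight i s)%:F = (1 - q_%:F ^+ i) / (1 - q_%:F) :> ratQqy.
Proof. by case=> ->; rewrite /= geometric_frac. Qed.

(* Main.v *)
Require Import Defs.
From mathcomp Require Import all_boot all_order all_algebra.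
From mathcomp Require Import ring zify.

(** Let [J] be the transfer matrix of the weighted paths, indexed by heights:
    [J = y D' + E'] where [D'] has [i+1]_q in positions (i, i), (i, i+1) and
    [E'] has [i]_q in positions (i, i), (i, i-1).  These matrices satisfy
    D'E' - q E'D' = D' + E', and the generating polynomial of the paths is
    e_0 J^n e_0 = y (e_0 + e_1) J^(n-1) e_0.  Put f_i = e_i + e_(i+1).  Then
      f_i D' = [i+1] f_i + [i+2] f_(i+1),
      f_i E' = [i] f_(i-1) + [i+1] f_i,
    so that f_0 E' = f_0: the row f_0 satisfies the equation asked of <W|.

    The proof transports this to arbitrary operators.  The first identity,
    read as a recursion with f_0 := <W|, defines linear forms on V
    ([shifted_form]); the relation DE - qED = D + E together with <W|E = <W|
    forces the second one ([shifted_formE]), and D|V> = |V> makes all of them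
    but the first vanish on |V> ([shifted_form_vec]).  The recursion divides by
    [i+2]_q, which is nonzero because q is an indeterminate ([qint_q_neq0]).

    On the combinatorial side, removing the first step shows that the sum
    G(i, m) over paths of length m from height i to 0 obeys the recursion
    of (J^m e_0)_i ([path_gfS]).  Hence f_i (yD + E)^m |V> = G(i, m) + G(i+1, m)
    by induction on m ([shifted_form_iter]).  For i = 0, multiplied by y, this
    is G(0, m+1). *)

Set Implicit Arguments.
Unset Strict Implicit.
Unset Printing Implicit Defensive.

Import Order.TTheory GRing.Theory Num.Theory.
Local Open Scope ring_scope.

(** * Linear forms generated by the functional *)

Definition qint (R : nzRingType) (q : R) (n : nat) : R := \sum_(k < n) q ^+ k.

Lemma qint0 (R : nzRingType) (q : R) : qint q 0 = 0.
Proof. exact: big_ord0. Qed.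

Lemma qintS (R : nzRingType) (q : R) (n : nat) :
  qint q n.+1 = 1 + q * qint q n.
Proof.
rewrite /qint big_ord_recl expr0 mulr_sumr; congr (1 + _).
by apply: eq_bigr => k _; rewrite -exprS.
Qed.

Lemma rmorph_qint (R S : nzRingType) (f : {rmorphism R -> S}) (q : R)
  (n : nat) : f (qint q n) = qint (f q) n.
Proof. by rewrite rmorph_sum; apply: eq_bigr => k _; rewrite rmorphXn. Qed.

(** The row f_i, with [D] in place of D': the recursive case is
    f_j D = [j+1] f_j + [j+2] f_(j+1) solved for f_(j+1). *)
Fixpoint shifted_form (F : fieldType) (V : lmodType F) (q : F) (D : V -> V)
  (W : V -> F) (i : nat) (u : V) : F :=
  if i is j.+1 then
    (shifted_form q D W j (D u) - qint q j.+1 * shifted_form q D W j u)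
      / qint q j.+2
  else W u.

Lemma shifted_form_linear (F : fieldType) (V : lmodType F) (q : F)
  (D : {linear V -> V}) (W : {scalar V}) (i : nat) :
  scalar (shifted_form q D W i).
Proof.
elim: i => [|i IH] a u w /=; first by rewrite linearP.
by rewrite linearP !IH; ring.
Qed.

Lemma shifted_formD (F : fieldType) (V : lmodType F) (q : F)
  (D : V -> V) (W : V -> F) (i : nat) (u : V) :
  (forall k, qint q k.+1 != 0) ->
  shifted_form q D W i (D u) =
  qint q i.+1 * shifted_form q D W i u
  + qint q i.+2 * shifted_form q D W i.+1 u.
Proof.
by move=> q_neq0 /=; rewrite [X in _ + X]mulrC divfK // addrC subrK.
Qed.

(** Here is where the commutation relation is used: it moves [E] through the
    [D] of the recursion, and the terms left over cancel since
    [1 - qint q i.+1 = - q * qint q i].  At [i = 0] the truncated [i.-1] comes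
    with the coefficient [qint q 0 = 0]. *)
Lemma shifted_formE (F : fieldType) (V : lmodType F) (q : F)
  (D E : {linear V -> V}) (W : {scalar V}) (i : nat) (u : V) :
  (forall k, qint q k.+1 != 0) ->
  (forall u, D (E u) - q *: E (D u) = D u + E u) ->
  (forall u, W (E u) = W u) ->
  shifted_form q D W i (E u) =
  qint q i * shifted_form q D W i.-1 u + qint q i.+1 * shifted_form q D W i u.
Proof.
move=> q_neq0 hDE hWE; elim: i u => [|i IH] u.
  by rewrite qintS qint0 /= hWE; ring.
have formD := shifted_formD D W _ _ q_neq0.
have prevD : qint q i * shifted_form q D W i.-1 (D u) =
    qint q i * (qint q i * shifted_form q D W i.-1 u
                + qint q i.+1 * shifted_form q D W i u).
  by case: i {IH} => [|i]; rewrite ?qint0 ?mul0r // formD.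
have DE_E : shifted_form q D W i (D (E u)) =
    q * shifted_form q D W i (E (D u))
    + (shifted_form q D W i (D u) + shifted_form q D W i (E u)).
  have -> : D (E u) = q *: E (D u) + (1 *: D u + E u).
    by rewrite scale1r -hDE addrC subrK.
  by rewrite !shifted_form_linear mul1r.
apply: (mulfI (q_neq0 i.+1)).
have -> : qint q i.+2 * shifted_form q D W i.+1 (E u) =
    shifted_form q D W i (D (E u)) - qint q i.+1 * shifted_form q D W i (E u).
  by rewrite formD addrC addKr.
rewrite DE_E (IH (D u)) prevD (IH u) formD [i.+1.-1]/= !qintS.
by ring.
Qed.

Lemma shifted_form_vec (F : fieldType) (V : lmodType F) (q : F)
  (D : V -> V) (W : V -> F) (v : V) (i : nat) :
  (forall k, qint q k.+1 != 0) -> D v = v -> W v = 1 ->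
  shifted_form q D W i v = (i == 0)%:R.
Proof.
move=> q_neq0 hDv hWv; elim: i => [|i IH] //=.
rewrite hDv IH; case: i {IH} => [|i] /=.
  by rewrite qintS qint0 mulr0 addr0 mul1r subrr mul0r.
by rewrite mulr0 subrr mul0r.
Qed.

(** The right-hand side reflects f_i = e_i + e_(i+1), with [g i m] in the role
    of the entry of index i of J^m e_0. *)
Lemma shifted_form_iter (F : fieldType) (V : lmodType F) (q y : F)
  (D E : {linear V -> V}) (W : {scalar V}) (v : V) (g : nat -> nat -> F)
  (i m : nat) :
  (forall k, qint q k.+1 != 0) ->
  (forall u, D (E u) - q *: E (D u) = D u + E u) ->
  (forall u, W (E u) = W u) -> D v = v -> W v = 1 ->
  (forall i, g i 0 = (i == 0)%:R) ->
  (forall i m, g i m.+1 = y * qint q i.+1 * (g i.+1 m + g i m)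
                          + qint q i * (g i.-1 m + g i m)) ->
  shifted_form q D W i (iter m (fun u => y *: D u + E u) v) =
  g i m + g i.+1 m.
Proof.
move=> q_neq0 hDE hWE hDv hWv g0 gS; elim: m i => [|m IH] i.
  by rewrite shifted_form_vec // !g0 addr0.
(* Both sides agree at [i = 0] because of the factor [qint q 0]. *)
have prev : qint q i * (g i.-1 m + g i.-1.+1 m) =
    qint q i * (g i.-1 m + g i m) :> F.
  by case: i => [|i] //; rewrite qint0 !mul0r.
rewrite iterS shifted_form_linear shifted_formD // shifted_formE // !IH !gS.
by rewrite prev // [i.+1.-1]/=; ring.
Qed.

(** * Paths from an arbitrary height *)

Definition next_height (i : nat) (s : step) : nat :=
  match s with
  | NorthEast => i.+1
  | SouthEast => i.-1
  | East1 | East2 => i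
  end.

(** Truncation in [next_height] is harmless: a south-east step from height 0
    has weight 0, so paths that go below 0 do not contribute. *)
Fixpoint weight_from (i : nat) (p : seq step) : polyQqy :=
  if p is s :: p' then step_weight i s * weight_from (next_height i s) p'
  else (i == 0)%:R.

Definition path_gf (i n : nat) : polyQqy :=
  \sum_(p : n.-tuple step) weight_from i p.

Lemma big_step (R : nmodType) (f : step -> R) :
  \sum_s f s = f NorthEast + f SouthEast + f East1 + f East2.
Proof.
rewrite (reindex step_decode) /=; last first.
  by exists step_code => [[[] []] | []].
transitivity (\sum_a \sum_b f (step_decode (a, b))).
  by rewrite pair_bigA; apply: eq_bigr => -[].
by rewrite !big_bool /= addrA.
Qed.

Lemma big_tuple_cons (R : nmodType) (T : finType) (n : nat) (f : seq T -> R) :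
  \sum_(p : n.+1.-tuple T) f p = \sum_s \sum_(p : n.-tuple T) f (s :: p).
Proof.
rewrite pair_bigA.
rewrite (reindex (fun x : T * n.-tuple T => [tuple of x.1 :: x.2])) //=.
exists (fun p => (thead p, [tuple of behead p])) => [[s p] _ | p _] /=.
  by congr (_, _); apply: val_inj.
by rewrite [RHS]tuple_eta.
Qed.

Lemma path_gf0 (i : nat) : path_gf i 0 = (i == 0)%:R.
Proof.
rewrite /path_gf (big_pred1 [tuple]) //= => p.
by rewrite (tuple0 p) /= eqxx.
Qed.

Lemma path_gfS (i n : nat) :
  path_gf i n.+1 = y_ * qint q_ i.+1 * (path_gf i.+1 n + path_gf i n)
                   + qint q_ i * (path_gf i.-1 n + path_gf i n).
Proof.
rewrite /path_gf big_tuple_cons big_step /= -!mulr_sumr -!/(path_gf _ _).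
by rewrite -![\sum_(k < _) q_ ^+ _]/(qint _ _) /qint; ring.
Qed.

(** The condition on heights in [motzkin], for a path starting at height [i];
    the sequence form makes it amenable to induction on the path. *)
Definition motzkin_from (i : nat) (p : seq step) : bool :=
  all (fun k => 0 <= i%:Z + height p k) (iota 0 (size p).+1)
  && (i%:Z + height p (size p) == 0).

Lemma height0 (p : seq step) : height p 0 = 0.
Proof. by rewrite /height take0 big_nil. Qed.

Lemma height_cons (s : step) (p : seq step) (k : nat) :
  height (s :: p) k.+1 = rise s + height p k.
Proof. by rewrite /height /= big_cons. Qed.

Lemma motzkin_from_cons (i j : nat) (s : step) (p : seq step) :
  i%:Z + rise s = j%:Z -> motzkin_from i (s :: p) = motzkin_from j p.
Proof.
move=> ij; rewrite /motzkin_from [size (s :: p)]/= height_cons addrA ij.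
rewrite -[(size p).+2]/(1 + (size p).+1)%N iotaD all_cat (iotaDl 1 0) all_map.
rewrite [all _ (iota 0 1)](_ : _ = true); last by rewrite /= height0 addr0.
by congr (_ && _); apply: eq_all => k; rewrite /= height_cons addrA ij.
Qed.

(** Once heights are known to stay nonnegative, the truncations in
    [weight_from] and in the absolute value never act, and the first step can
    be removed on both sides by shifting the initial height.  The only other
    case is a first step south-east from height 0, where both sides vanish. *)
Lemma weight_fromE (i : nat) (p : seq step) :
  weight_from i p =
  if motzkin_from i p then
    \prod_(k < size p) step_weight `|(i%:Z + height p k)%R|%N (nth East1 p k)
  else 0.
Proof.
elim: p i => [|s p IH] i.
  rewrite /motzkin_from /= big_ord0 height0 addr0.
  by case: i.
have cons_case j : i%:Z + rise s = j%:Z ->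
    step_weight i s * weight_from j p =
    if motzkin_from i (s :: p) then
      \prod_(k < size (s :: p))
        step_weight `|(i%:Z + height (s :: p) k)%R|%N (nth East1 (s :: p) k)
    else 0.
  move=> ij; rewrite (motzkin_from_cons _ ij) IH.
  case: ifP => _; last by rewrite mulr0.
  rewrite big_ord_recl height0 addr0 /=; congr (_ * _).
  by apply: eq_bigr => k _; rewrite height_cons addrA ij.
case: s cons_case => cons_case /=; try by apply: cons_case => /=; lia.
case: i cons_case => [|i] cons_case; last by apply: cons_case => /=; lia.
by rewrite big_ord0 mul0r /motzkin_from /= height_cons !height0.
Qed.

Lemma motzkin_gfE (n : nat) : motzkin_gf n = path_gf 0 n.
Proof.
rewrite /motzkin_gf /path_gf big_mkcond; apply: eq_bigr => p _.
rewrite weight_fromE size_tuple.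
have -> : motzkin_from 0 p = motzkin p.
  rewrite /motzkin_from /motzkin size_tuple add0r; congr (_ && _).
  apply/allP/forallP => [h k | h k].
    by rewrite -[height p k]add0r; apply: h; rewrite mem_iota /=.
  by rewrite mem_iota add0r => /= kn; apply: (h (Ordinal kn)).
case: ifP => // _; apply: eq_bigr => k _.
by rewrite add0r (tnth_nth East1).
Qed.

(** * Specialization to the indeterminates *)

(** At q = 0 the polynomial takes the value 1. *)
Lemma qint_q_neq0 (n : nat) : qint q_ n.+1 != 0.
Proof.
rewrite /q_ -rmorph_qint polyC_eq0; apply/eqP => /(congr1 (horner^~ 0)).
rewrite qintS hornerD hornerM hornerX mul0r addr0 hornerC horner0.
by apply/eqP; rewrite oner_eq0.
Qed.

Theorem proposition3 (F : fieldType)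
  (iota : {rmorphism ratQqy -> F})
  (V : lmodType F) (D E : {linear V -> V}) (W : {scalar V}) (v : V)
  (hDE : forall u : V, D (E u) - iota q_%:F *: E (D u) = D u + E u)
  (hWE : forall u : V, W (E u) = W u)
  (hDv : D v = v)
  (hWv : W v = 1)
  (n : nat) (hn : (1 <= n)%N) :
  iota y_%:F * W (iter n.-1 (fun u : V => iota y_%:F *: D u + E u) v) =
  iota (motzkin_gf n)%:F.
Proof.
pose c : {rmorphism polyQqy -> F} := iota \o (@FracField.tofrac polyQqy).
case: n hn => // n _; rewrite motzkin_gfE [n.+1.-1]/=.
have c_qint k : qint (iota q_%:F) k = c (qint q_ k) by rewrite rmorph_qint.
have q_neq0 k : qint (iota q_%:F) k.+1 != 0.
  by rewrite c_qint /= fmorph_eq0 tofrac_eq0 qint_q_neq0.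
rewrite -[W _]/(shifted_form (iota q_%:F) D W 0 _).
rewrite (@shifted_form_iter _ _ _ _ _ _ _ _ (fun i m => c (path_gf i m))) //.
- rewrite -[iota (path_gf 0 n.+1)%:F]/(c _) path_gfS qint0 mul0r addr0 qintS.
  rewrite qint0 mulr0 addr0 mulr1 -[iota y_%:F]/(c y_) -rmorphD -rmorphM.
  by rewrite addrC.
- by move=> i; rewrite path_gf0 rmorph_nat.
- by move=> i m; rewrite path_gfS !rmorphD !rmorphM !rmorphD !c_qint.
Qed.
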